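(* The logic $\mathbf{CL}$ is sound and complete with respect to the class of all selection L-frames: a consequence pair $\phi\trianglelefteq\psi$ belongs to $\mathbf{CL}$ if and only if it is validated by every selection L-frame.
   Context: Formulas: $\phi::=p\mid\top\mid\bot\mid\phi\wedge\phi\mid\phi\vee\phi\mid\phi\Rightarrow\phi$, $p$ from a fixed set of letters; consequence pairs are expressions $\phi\trianglelefteq\psi$. $\mathbf{CL}$ is the smallest set of consequence pairs closed under uniform substitution, containing $p\trianglelefteq\top$, $\bot\trianglelefteq p$, $p\trianglelefteq p$, $p\wedge q\trianglelefteq p$, $p\wedge q\trianglelefteq q$, $p\trianglelefteq p\vee q$, $q\trianglelefteq p\vee q$, $\top\trianglelefteq p\Rightarrow\top$, $p\Rightarrow(q\wedge r)\trianglelefteq(p\Rightarrow q)\wedge(p\Rightarrow r)$, $(p\Rightarrow q)\wedge(p\Rightarrow r)\trianglelefteq p\Rightarrow(q\wedge r)$, and closed under: from $p\trianglelefteq q,q\trianglelefteq r$ infer $p\trianglelefteq r$; from $r\trianglelefteq p,r\trianglelefteq q$ infer $r\trianglelefteq p\wedge q$; from $p\trianglelefteq r,q\trianglelefteq r$ infer $p\vee q\trianglelefteq r$; from $p\trianglelefteq q$ and $q\trianglelefteq p$ infer $p\Rightarrow r\trianglelefteq q\Rightarrow r$ and $r\Rightarrow p\trianglelefteq r\Rightarrow q$. A meet-semilattice $(X,1,\curlywedge)$ has top $1$ and order $x\preccurlyeq y$ iff $x\curlywedge y=x$; a filter is an upward closed subset closed under finite meets; $\mathcal F(X)$ is the set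 of filters. A selection L-frame is $(X,1,\curlywedge,s)$ with $s:X\times\mathcal F(X)\to\mathcal F(X)$ such that for all $x,y,z\in X$, $a\in\mathcal F(X)$: $s(1,a)=\{1\}$; $x\preccurlyeq y$ implies $s(y,a)\subseteq s(x,a)$; if $z\in s(x\curlywedge y,a)$ there are $u\in s(x,a)$, $v\in s(y,a)$ with $u\curlywedge v\preccurlyeq z$. A valuation $V$ assigns a filter to each letter; truth: $x\Vdash p$ iff $x\in V(p)$; $\top$ always; $x\Vdash\bot$ iff $x=1$; $\wedge$ pointwise; $x\Vdash\phi\vee\psi$ iff there are $y\Vdash\phi$, $z\Vdash\psi$ with $y\curlywedge z\preccurlyeq x$; $x\Vdash\phi\Rightarrow\psi$ iff $s(x,[\![\phi]\!])\subseteq[\![\psi]\!]$ where $[\![\phi]\!]$ is the truth set. A frame validates $\phi\trianglelefteq\psi$ if $[\![\phi]\!]\subseteq[\![\psi]\!]$ for every valuation. *)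

(* Defs.v *)
From HB Require Import structures.
From mathcomp Require Import all_boot all_order.
From mathcomp Require Import boolp classical_sets.

Set Implicit Arguments.
Unset Strict Implicit.
Unset Printing Implicit Defensive.

Import Order.TTheory.
Local Open Scope order_scope.

Inductive form (L : Type) : Type :=
| Var of L
| Top
| Bot
| And of form L & form L
| Or of form L & form L
| Imp of form L & form L.

Arguments Top {L}.
Arguments Bot {L}.

Fixpoint subst (L : Type) (sigma : L -> form L) (phi : form L) : form L :=
  match phi with
  | Var p => sigma p
  | Top => Top
  | Bot => Bot
  | And phi1 phi2 => And (subst sigma phi1) (subst sigma phi2)
  | Or phi1 phi2 => Or (subst sigma phi1) (subst sigma phi2)
  | Imp phi1 phi2 => Imp (subst sigma phi1) (subst sigma phi2)
  end.

(* [CL phi psi] says that the consequence pair (phi, psi) belongs to CL.  The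
   p, q, r of the axioms and rules range over formulas, so that nothing is
   assumed about the number of letters in [L]. *)
Inductive CL (L : Type) : form L -> form L -> Prop :=
| CL_subst sigma p q : CL p q -> CL (subst sigma p) (subst sigma q)
| CL_top p : CL p Top
| CL_bot p : CL Bot p
| CL_refl p : CL p p
| CL_andl p q : CL (And p q) p
| CL_andr p q : CL (And p q) q
| CL_orl p q : CL p (Or p q)
| CL_orr p q : CL q (Or p q)
| CL_imp_top p : CL Top (Imp p Top)
| CL_imp_and p q r : CL (Imp p (And q r)) (And (Imp p q) (Imp p r))
| CL_and_imp p q r : CL (And (Imp p q) (Imp p r)) (Imp p (And q r))
| CL_trans p q r : CL p q -> CL q r -> CL p r
| CL_and p q r : CL r p -> CL r q -> CL r (And p q)
| CL_or p q r : CL p r -> CL q r -> CL (Or p q) r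
| CL_congl p q r : CL p q -> CL q p -> CL (Imp p r) (Imp q r)
| CL_congr p q r : CL p q -> CL q p -> CL (Imp r p) (Imp r q).

(* Filters are closed under finite meets, the empty meet [\top] included. *)
Record semilattice_filter (d : Order.disp_t) (X : tMeetSemilatticeType d) :
    Type := SemilatticeFilter {
  filter_set :> set X;
  filter_up : forall x y : X, x <= y -> filter_set x -> filter_set y;
  filter_top : filter_set \top;
  filter_meet : forall x y : X,
    filter_set x -> filter_set y -> filter_set (x `&` y)
}.

Record selection_frame (d : Order.disp_t) : Type := SelectionFrame {
  carrier :> tMeetSemilatticeType d;
  sel : carrier -> semilattice_filter carrier -> semilattice_filter carrier;
  sel_top : forall a, sel \top a = [set \top]%classic :> set carrier;
  sel_anti : forall (x y : carrier) a,
    x <= y -> (sel y a `<=` sel x a)%classic;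
  sel_meet : forall (x y z : carrier) a, filter_set (sel (x `&` y) a) z ->
    exists u v : carrier, [/\ filter_set (sel x a) u, filter_set (sel y a) v
                         & u `&` v <= z]
}.

(* A truth set is an argument of the selection function, so each clause of the
   truth definition comes with the proof that it defines a filter. *)
Section TruthClauses.
Local Obligation Tactic := try by [].
Context {d : Order.disp_t}.

Section Semilattice.
Variable X : tMeetSemilatticeType d.
Implicit Types a b : semilattice_filter X.

Program Definition top_filter : semilattice_filter X :=
  @SemilatticeFilter d X (fun=> True) _ _ _.

Program Definition bot_filter : semilattice_filter X :=
  @SemilatticeFilter d X (fun x => x = \top) _ _ _.
Next Obligation. by move=> x y le_xy xT; apply/eqP; rewrite -le1x -xT. Qed.
Next Obligation. by move=> x y -> ->; rewrite meetxx. Qed.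

Program Definition and_filter a b : semilattice_filter X :=
  @SemilatticeFilter d X (fun x => filter_set a x /\ filter_set b x) _ _ _.
Next Obligation.
by move=> a b x y le_xy [ax bx]; split; apply: filter_up le_xy _.
Qed.
Next Obligation. by move=> a b; split; apply: filter_top. Qed.
Next Obligation.
by move=> a b x y [ax bx] [ay yb]; split; apply: filter_meet.
Qed.

Program Definition or_filter a b : semilattice_filter X :=
  @SemilatticeFilter d X (fun x => exists y z : X,
    [/\ filter_set a y, filter_set b z & y `&` z <= x]) _ _ _.
Next Obligation.
move=> a b x y le_xy [u [v [au bv le_x]]].
by exists u, v; split=> //; apply: le_trans le_xy.
Qed.
Next Obligation.
by move=> a b; exists \top, \top; split; rewrite ?lex1 //; apply: filter_top.
Qed.
Next Obligation.
move=> a b x y [u [v [au bv le_x]]] [u' [v' [au' bv' le_y]]].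
exists (u `&` u'), (v `&` v'); split; [exact: filter_meet.. |].
by rewrite meetACA leI2.
Qed.

End Semilattice.

Program Definition imp_filter (F : selection_frame d)
    (a b : semilattice_filter F) : semilattice_filter F :=
  @SemilatticeFilter d F (fun x => (sel x a `<=` b)%classic) _ _ _.
Next Obligation.
move=> F a b x y le_xy sxb; exact: subset_trans (sel_anti le_xy) sxb.
Qed.
Next Obligation.
by move=> F a b x; rewrite sel_top => ->; apply: filter_top.
Qed.
Next Obligation.
move=> F a b x y sxb syb z /sel_meet[u [v [su sv le_z]]].
by apply: filter_up le_z _; apply: filter_meet; [exact: sxb | exact: syb].
Qed.

End TruthClauses.

(* [truth_set V phi x] is the truth of [phi] at [x] under the valuation [V]. *)
Fixpoint truth_set (L : Type) (d : Order.disp_t) (F : selection_frame d)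
    (V : L -> semilattice_filter F) (phi : form L) : semilattice_filter F :=
  match phi with
  | Var p => V p
  | Top => top_filter F
  | Bot => bot_filter F
  | And phi1 phi2 => and_filter (truth_set V phi1) (truth_set V phi2)
  | Or phi1 phi2 => or_filter (truth_set V phi1) (truth_set V phi2)
  | Imp phi1 phi2 => imp_filter (truth_set V phi1) (truth_set V phi2)
  end.

Definition validates (L : Type) (d : Order.disp_t) (F : selection_frame d)
    (phi psi : form L) : Prop :=
  forall V : L -> semilattice_filter F,
    (truth_set V phi `<=` truth_set V psi)%classic.

(* Main.v *)
(** Completeness: the points of the canonical frame are the CL-theories ordered
    by inclusion, with all formulas as top and intersection as meet.  The
    selection function sends [(x, a)] to the principal filter generated by the
    theory [selected x a] of all [psi] such that [Imp phi psi] lies in [x] for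
    every [phi] defining [a].  Congruence in the antecedent makes this
    condition independent of the choice of [phi], and when no [phi] defines [a]
    it is vacuous, so that [(x, a)] is sent to the singleton of the top. *)

Require Import Defs.
From mathcomp Require Import all_boot all_order.
From HB Require Import structures.
From mathcomp Require Import boolp classical_sets.

Set Implicit Arguments.
Unset Strict Implicit.
Unset Printing Implicit Defensive.

Import Order.TTheory.
Local Open Scope order_scope.

Lemma filter_eq (d : Order.disp_t) (X : tMeetSemilatticeType d)
    (a b : semilattice_filter X) :
  (a `<=` b)%classic -> (b `<=` a)%classic -> a = b.
Proof.
move: a b => [a ua ta ma] [b ub tb mb] /= le_ab le_ba.
have eq_ab : a = b by apply/seteqP.
by subst b; congr SemilatticeFilter; apply: Prop_irrelevance.
Qed.

Definition up_filter (d : Order.disp_t) (X : tMeetSemilatticeType d) (x : X) :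
    semilattice_filter X.
Proof.
apply: (@SemilatticeFilter d X (fun y => x <= y)).
- by move=> y z le_yz le_xy; apply: le_trans le_yz.
- exact: lex1.
- by move=> y z le_xy le_xz; rewrite lexI le_xy.
Defined.

(** Substituting amounts to changing the valuation, so validity under all valuations survives
    [CL_subst]. *)
Lemma truth_set_subst (L : Type) (d : Order.disp_t) (F : selection_frame d)
    (V : L -> semilattice_filter F) (sigma : L -> form L) (phi : form L) :
  truth_set V (subst sigma phi) =
  truth_set (fun p => truth_set V (sigma p)) phi.
Proof. by elim: phi => //= phi -> psi ->. Qed.

Lemma CL_sound (L : Type) (d : Order.disp_t) (F : selection_frame d)
    (phi psi : form L) :
  CL phi psi -> validates F phi psi.
Proof.
rewrite /validates.
elim=> {phi psi}
  [sigma p q _ IH|p|p|p|p q|p q|p q|p q|p|p q r|p q r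
  |p q r _ IHpq _ IHqr|p q r _ IHp _ IHq|p q r _ IHp _ IHq
  |p q r _ IHpq _ IHqp|p q r _ IHpq _ IHqp] V x /=.
- by rewrite !truth_set_subst; apply: IH.
- by [].
- by move=> ->; apply: filter_top.
- by [].
- by case.
- by case.
(* Every filter contains [\top], which stands in for the other disjunct. *)
- by exists x, \top; rewrite meetx1; split=> //; apply: filter_top.
- by exists \top, x; rewrite meet1x; split=> //; apply: filter_top.
- by [].
- by move=> s_qr; split=> y /s_qr[].
- by move=> [s_q s_r] y sy; split; [apply: s_q | apply: s_r].
- by move=> /IHpq /IHqr.
- by move=> rx; split; [apply: IHp | apply: IHq].
- move=> [y [z [/IHp ry /IHq rz le_x]]].
  by apply: filter_up le_x _; apply: filter_meet.
(* Truth sets are arguments of the selection function, so the two inclusions are turned into an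
   equality of filters. *)
- by rewrite (filter_eq (IHpq V) (IHqp V)).
- by rewrite (filter_eq (IHpq V) (IHqp V)).
Qed.

(** The rules give only congruence in the consequent. Here [p] is interderivable with [And p q], and
    [Imp r] distributes over [And]. *)
Lemma CL_imp_mono (L : Type) (r p q : form L) :
  CL p q -> CL (Imp r p) (Imp r q).
Proof.
move=> le_pq; apply: CL_trans (CL_andr (Imp r p) (Imp r q)).
apply: CL_trans (CL_imp_and r p q); apply: CL_congr (CL_andl p q).
by apply: CL_and le_pq; apply: CL_refl.
Qed.

(** These are the filters of the Lindenbaum preorder. The inconsistent theory is among them: it is
    the top point, where [Bot] holds. *)
Record theory (L : Type) : Type := Theory {
  theory_set :> set (form L);
  theory_up : forall p q, CL p q -> theory_set p -> theory_set q;
  theory_top : theory_set Top;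
  theory_and : forall p q, theory_set p -> theory_set q -> theory_set (And p q)
}.

Lemma theory_eq (L : Type) (x y : theory L) : x = y :> set (form L) -> x = y.
Proof.
move: x y => [x ux tx ax] [y uy ty ay] /= eq_xy.
by subst y; congr Theory; apply: Prop_irrelevance.
Qed.

Definition theory_le (L : Type) (x y : theory L) : bool :=
  `[< x `<=` y >]%classic.

Lemma theory_le_refl (L : Type) : reflexive (@theory_le L).
Proof. by move=> x; apply/asboolP. Qed.

Lemma theory_le_anti (L : Type) : antisymmetric (@theory_le L).
Proof.
move=> x y /andP[/asboolP le_xy /asboolP le_yx].
by apply: theory_eq; apply/seteqP.
Qed.

Lemma theory_le_trans (L : Type) : transitive (@theory_le L).
Proof.
move=> y x z /asboolP le_xy /asboolP le_yz; apply/asboolP.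
exact: subset_trans le_yz.
Qed.

Definition theory_all (L : Type) : theory L.
Proof. by apply: (@Theory L (fun=> True)). Defined.

Definition theory_meet (L : Type) (x y : theory L) : theory L.
Proof.
apply: (@Theory L (x `&` y)%classic).
- by move=> p q le_pq [xp yp]; split; apply: theory_up le_pq _.
- by split; apply: theory_top.
- by move=> p q [xp yp] [xq yq]; split; apply: theory_and.
Defined.

Definition theory_gen (L : Type) (phi : form L) : theory L.
Proof.
apply: (@Theory L (CL phi)).
- by move=> p q le_pq le_phi; apply: CL_trans le_pq.
- exact: CL_top.
- by move=> p q; apply: CL_and.
Defined.

HB.instance Definition _ (L : Type) := gen_eqMixin (theory L).
HB.instance Definition _ (L : Type) := gen_choiceMixin (theory L).

Fact theory_display : Order.disp_t. Proof. exact: Order.Disp tt tt. Qed.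

HB.instance Definition _ (L : Type) :=
  Order.Le_isPOrder.Build theory_display (theory L)
    (@theory_le_refl L) (@theory_le_anti L) (@theory_le_trans L).

Lemma theory_leP (L : Type) (x y : theory L) :
  reflect (x `<=` y)%classic (x <= y).
Proof. exact: asboolP. Qed.

Lemma theory_lex1 (L : Type) (x : theory L) : x <= theory_all L.
Proof. by apply/theory_leP. Qed.

Lemma theory_lexI (L : Type) (x y z : theory L) :
  (x <= theory_meet y z) = (x <= y) && (x <= z).
Proof.
apply/theory_leP/andP => [le_x | [/theory_leP le_xy /theory_leP le_xz]].
  by split; apply/theory_leP => p /le_x[].
by move=> p xp; split; [apply: le_xy | apply: le_xz].
Qed.

HB.instance Definition _ (L : Type) :=
  Order.hasTop.Build theory_display (theory L) (@theory_lex1 L).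
HB.instance Definition _ (L : Type) :=
  Order.POrder_isMeetSemilattice.Build theory_display (theory L)
    (@theory_lexI L).

Definition canonical_set (L : Type) (phi : form L) :
    semilattice_filter (theory L).
Proof.
apply: (@SemilatticeFilter _ (theory L) (fun x => theory_set x phi)).
- by move=> x y /theory_leP; apply.
- by [].
- by [].
Defined.

(** The least theory containing [phi] consists of the consequences of [phi], so the inclusion is
    tested there. *)
Lemma canonical_set_sub (L : Type) (phi psi : form L) :
  (canonical_set phi `<=` canonical_set psi)%classic -> CL phi psi.
Proof. by move=> /(_ (theory_gen phi)); apply; apply: CL_refl. Qed.

Definition selected (L : Type) (x : theory L)
    (a : semilattice_filter (theory L)) : theory L.
Proof.
apply: (@Theory L (fun psi => forall phi, canonical_set phi = a ->
                     theory_set x (Imp phi psi))).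
- move=> p q le_pq sp phi /sp; apply: theory_up; exact: CL_imp_mono.
- by move=> phi _; apply: theory_up (CL_imp_top phi) (theory_top x).
- move=> p q sp sq phi def_a; apply: theory_up (CL_and_imp phi p q) _.
  by apply: theory_and; [apply: sp | apply: sq].
Defined.

Lemma selected_canonical (L : Type) (x : theory L) (phi psi : form L) :
  theory_set (selected x (canonical_set phi)) psi <->
  theory_set x (Imp phi psi).
Proof.
split=> [|x_imp chi eq_phi]; first exact.
(* Equal canonical sets make [phi] and [chi] interderivable. *)
by apply: theory_up x_imp; apply: CL_congl; apply: canonical_set_sub;
  rewrite eq_phi.
Qed.

Definition canonical_frame (L : Type) : selection_frame theory_display.
Proof.
apply: (@SelectionFrame _ (theory L) (fun x a => up_filter (selected x a))).
(* The top theory contains every implication, so it selects all formulas. *)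
- move=> a; apply/seteqP; split=> [x /theory_leP le_x | x ->]; last exact: lex1.
  by apply/eqP; rewrite -le1x; apply/theory_leP => p _; apply: le_x.
- move=> x y a /theory_leP le_xy z; apply: le_trans.
  by apply/theory_leP => p sp phi /sp; apply: le_xy.
- move=> x y z a /theory_leP le_z.
  (* The witnesses generate the two principal filters. A formula selected by both [x] and [y] is
     selected by their intersection, hence lies in [z]. *)
  exists (selected x a), (selected y a); split; [exact: lexx.. |].
  apply/theory_leP => p [sxp syp]; apply: le_z => phi def_a.
  by split; [apply: sxp | apply: syp].
Defined.

(** Truth is membership. As an equality of filters, the induction hypothesis also rewrites the
    antecedent inside the selection function. *)
Lemma canonical_truth (L : Type) (phi : form L) :
  truth_set (F := canonical_frame L) (@canonical_set L \o @Var L) phi =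
  canonical_set phi.
Proof.
elim: phi => [p|||p IHp q IHq|p IHp q IHq|p IHp q IHq] //=;
  rewrite ?IHp ?IHq; apply: filter_eq => x /=.
- by move=> _; apply: theory_top.
- by [].
- by move=> ->.
- move=> x_bot; apply/eqP; rewrite -le1x; apply/theory_leP => p _.
  exact: theory_up (CL_bot p) x_bot.
- by case; apply: theory_and.
- move=> x_and; split; apply: theory_up x_and; first exact: CL_andl.
  exact: CL_andr.
- move=> [y [z [yp zq /theory_leP]]]; apply; split.
    exact: theory_up (CL_orl p q) yp.
  exact: theory_up (CL_orr p q) zq.
(* A common consequence of [p] and [q] is a consequence of [Or p q], so these two theories meet
   below [x]. *)
- move=> x_or; exists (theory_gen p), (theory_gen q).
  split; [exact: CL_refl.. |]; apply/theory_leP => r [le_pr le_qr].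
  exact: theory_up (CL_or le_pr le_qr) x_or.
(* A principal filter lies in [canonical_set q] exactly when its generator contains [q]. *)
- by move=> s_q; apply/selected_canonical; apply: s_q; apply: lexx.
- by move=> /selected_canonical sq y /theory_leP; apply.
Qed.

Theorem theorem4p12 (L : Type) (phi psi : form L) :
  CL phi psi <->
  forall (d : Order.disp_t) (F : selection_frame d), validates F phi psi.
Proof.
split=> [CL_phi d F|valid]; first exact: CL_sound.
apply: canonical_set_sub; rewrite -!canonical_truth.
by apply: (valid _ (canonical_frame L)).
Qed.
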